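(* There exists a Scheepers-bounded subgroup of $\mathbb{Z}^{\mathbb{N}}$ which is not Hurewicz-bounded.
   Context: The group $\mathbb{Z}^{\mathbb{N}}$ carries pointwise addition and the product topology ($\mathbb{Z}$ discrete); subgroups carry the subspace topology. A topological group $(G,\cdot)$ is Scheepers-bounded if for each sequence $(U_n)_{n\in\mathbb{N}}$ of neighborhoods of the unit there exist finite $F_n\subseteq G$ such that for each finite $F\subseteq G$ there is $n$ with $F\subseteq F_n\cdot U_n$; it is Hurewicz-bounded if for each such sequence there exist finite $F_n\subseteq G$ such that each $g\in G$ belongs to $F_n\cdot U_n$ for all but finitely many $n$. Here $A\cdot B=\{a\cdot b:a\in A,\ b\in B\}$. *)

(* Defs.v *)
From HB Require Import structures.
From mathcomp Require Import all_boot all_order all_algebra.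
From mathcomp Require Import all_classical.
From mathcomp Require Import topology tvs.

Set Implicit Arguments.
Unset Strict Implicit.
Unset Printing Implicit Defensive.

Import GRing.Theory.
Local Open Scope classical_set_scope.
Local Open Scope ring_scope.

HB.instance Definition _ := hasNbhs.Build int principal_filter.
HB.instance Definition _ := Discrete_ofNbhs.Build int erefl.

Lemma int_sub_continuous : continuous (fun x : int * int => x.1 - x.2).
Proof.
move=> [a b] A /=; rewrite nbhs_principalE => /principal_filterP Aab.
exists ([set a], [set b]); first by split; exact: discrete_set1.
by move=> [c d] [/= -> ->].
Qed.

HB.instance Definition _ :=
  PreTopologicalNmodule_isTopologicalZmodule.Build int int_sub_continuous.

(* The product topology is the one of [prod_topology]; plain arrow types have
   no canonical topology in the library, hence {ptws I -> M}. *)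
HB.instance Definition _ (I : Type) (M : zmodType) :=
  GRing.Zmodule.copy {ptws I -> M} (I -> M).

Lemma ptws_sub_continuous (I : Type) (M : topologicalZmodType) :
  continuous (fun x : {ptws I -> M} * {ptws I -> M} => x.1 - x.2).
Proof.
move=> [f g]; apply/cvg_sup => i A.
rewrite nbhsE => -[_ [[B oB <-] Bfg] BA].
have nB : nbhs (f i - g i) B by apply: open_nbhs_nbhs.
have evi : continuous (fun h : {ptws I -> M} => h i).
  move=> h; have /cvg_sup/(_ i) hi : h --> h by apply: cvg_id.
  move=> V /=; rewrite nbhsE => -[W [oW Wh] WV].
  apply: hi; rewrite nbhsE; exists ((fun k : {ptws I -> M} => k i) @^-1` W).
    by split=> //; exists W.
  by move=> k /= /WV.
have [[P Q] /= [nP nQ] PQB] := @sub_continuous M (f i, g i) B nB.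
exists ((fun h : {ptws I -> M} => h i) @^-1` P,
        (fun h : {ptws I -> M} => h i) @^-1` Q).
  by split; [exact: (evi f P nP) | exact: (evi g Q nQ)].
by move=> [h k] /= [Ph Qk]; apply: BA; exact: (PQB (h i, k i)).
Qed.

HB.instance Definition _ (I : Type) (M : topologicalZmodType) :=
  PreTopologicalNmodule_isTopologicalZmodule.Build {ptws I -> M}
    (@ptws_sub_continuous I M).

(* A [zmodClosed M] is a subgroup of M: although it is a boolean predicate, any
   [set M] can be turned into one, membership being classically decidable. *)
Definition subgroup_type (M : zmodType) (G : zmodClosed M) : Type :=
  {x : M | x \in G}.

HB.instance Definition _ (M : zmodType) (G : zmodClosed M) :=
  SubChoice.on (subgroup_type G).
HB.instance Definition _ (M : zmodType) (G : zmodClosed M) :=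
  [SubChoice_isSubZmodule of subgroup_type G by <:].

HB.instance Definition _ (M : topologicalZmodType) (G : zmodClosed M) :=
  Topological.copy (subgroup_type G)
    (initial_topology (val : subgroup_type G -> M)).

Lemma subgroup_sub_continuous (M : topologicalZmodType) (G : zmodClosed M) :
  continuous (fun x : subgroup_type G * subgroup_type G => x.1 - x.2).
Proof.
have valc : continuous (val : subgroup_type G -> M).
  exact: initial_continuous.
move=> [x y] A /=; rewrite nbhsE => -[_ [[B oB <-] Bxy] BA].
have nB : nbhs (val x - val y) B by apply: open_nbhs_nbhs.
have [[P Q] /= [nP nQ] PQB] := @sub_continuous M (val x, val y) B nB.
exists (val @^-1` P, val @^-1` Q).
  by split; [exact: (valc x P nP) | exact: (valc y Q nQ)].
by move=> [z t] /= [Pz Qt]; apply: BA; exact: (PQB (val z, val t)).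
Qed.

HB.instance Definition _ (M : topologicalZmodType) (G : zmodClosed M) :=
  PreTopologicalNmodule_isTopologicalZmodule.Build (subgroup_type G)
    (@subgroup_sub_continuous M G).

(* Boundedness of a topological group, in additive notation for abelian groups;
   the F n are subsets of the group itself, not of an ambient group. *)
Definition Scheepers_bounded (G : topologicalZmodType) : Prop :=
  forall U : nat -> set G, (forall n, nbhs (0 : G) (U n)) ->
  exists2 F : nat -> set G, (forall n, finite_set (F n)) &
    forall A : set G, finite_set A ->
      exists n, A `<=` [set a + b | a in F n & b in U n].

Definition Hurewicz_bounded (G : topologicalZmodType) : Prop :=
  forall U : nat -> set G, (forall n, nbhs (0 : G) (U n)) ->
  exists2 F : nat -> set G, (forall n, finite_set (F n)) &
    forall g : G,
      \forall n \near \oo, [set a + b | a in F n & b in U n] g.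

(* Main.v *)
From HB Require Import structures.
Require Import Defs.
From mathcomp Require Import all_boot all_order all_algebra.
From mathcomp Require Import all_classical topology tvs.
From mathcomp Require Import finmap zify.

(** Fix an ultrafilter [U] on the naturals extending the cofinite filter, and
    let [G] consist of the [f] such that, for some [K], [|f i| <= K * n] for all
    [i <= n], for [U]-many [n].  This is a subgroup, and finitely many of its
    elements are simultaneously bounded by [n * n] on the initial segment
    [0 .. n], for infinitely many [n]; as only finitely many restrictions obey
    such a bound, [G] is Scheepers-bounded.  On the other hand [G] is not
    eventually dominated by any [h]: take a strictly increasing sequence [a]
    with [h (a k) < a (k + 1)].  One of the two unions of the alternate
    intervals [a k .. a (k + 1)[ belongs to [U], and the monotone function equal
    to [a k] on the chosen intervals and to [a (k + 1)] on the other ones is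
    below the identity on the chosen union, but exceeds [h] at infinitely many
    of the [a k]. *)

Set Implicit Arguments.
Unset Strict Implicit.
Unset Printing Implicit Defensive.

Import GRing.Theory.
Local Open Scope classical_set_scope.

Lemma zmodClosed_of_set (M : zmodType) (P : set M) :
    P 0%R -> (forall x y, P x -> P y -> P (x - y)%R) ->
  exists G : zmodClosed M, forall x, (x \in G) <-> P x.
Proof.
move=> P0 PB; pose S : {pred M} := [pred x | `[< P x >]].
have cS : zmod_closed S.
  by split=> [|x y /asboolP Px /asboolP Py]; apply/asboolP => //; exact: PB.
pose iS := GRing.isZmodClosed.Build M S cS.
pose G : zmodClosed M := HB.pack S iS.
by exists G => x; split=> [/asboolP|Px] //; apply/asboolP.
Qed.

Lemma ptws_eval_continuous (I : Type) (M : topologicalType) (i : I) :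
  continuous (fun f : {ptws I -> M} => f i).
Proof.
move=> f; have /cvg_sup/(_ i) fi : f --> f by apply: cvg_id.
move=> V /=; rewrite nbhsE => -[W [oW Wf] WV].
apply: fi; rewrite nbhsE; exists ((fun k : {ptws I -> M} => k i) @^-1` W).
  by split=> //; exists W.
by move=> k /= /WV.
Qed.

(** The filter generated by the sets [Z m] converges to 0 in each coordinate, hence in the product
    topology. *)
Lemma ptws_nbhs0 (B : set {ptws nat -> int}) :
    nbhs (0%R : {ptws nat -> int}) B ->
  exists m, forall f : {ptws nat -> int},
    (forall i, i < m -> f i = 0%R) -> B f.
Proof.
pose Z m : set {ptws nat -> int} := [set f | forall i, i < m -> f i = 0%R].
have FZ : Filter (filter_from setT Z).
  apply: filter_fromT_filter; first by exists 0.
  move=> m n; exists (maxn m n) => f Zf.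
  by split=> i lti; apply: Zf; rewrite leq_max lti ?orbT.
suff Z0 : filter_from setT Z --> (0%R : {ptws nat -> int}).
  by move=> /Z0 [m _ ZB]; exists m.
apply/cvg_sup => i A; rewrite nbhsE => -[_ [[V oV <-] V0] VA].
exists i.+1 => // f Zf; apply: VA => /=.
by rewrite Zf.
Qed.

Section Subgroup.
Variable G : zmodClosed {ptws nat -> int}.

Let coord (g : subgroup_type G) (i : nat) : int := (val g : {ptws nat -> int}) i.

Lemma subgroup_nbhs0 (V : set (subgroup_type G)) :
    nbhs (0%R : subgroup_type G) V ->
  exists m, forall g, (forall i, i < m -> coord g i = 0%R) -> V g.
Proof.
rewrite nbhsE => -[_ [[B oB <-] B0] BV].
have /ptws_nbhs0 [m mB] : nbhs (0%R : {ptws nat -> int}) B.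
  exact: open_nbhs_nbhs.
by exists m => g g0; apply: BV; exact: mB.
Qed.

Lemma nbhs0_coord_eq0 n :
  nbhs (0%R : subgroup_type G) [set g | coord g n = 0%R].
Proof.
have vc : continuous (val : subgroup_type G -> {ptws nat -> int}).
  exact: initial_continuous.
apply: (vc _ [set f : {ptws nat -> int} | f n = 0%R]).
exact: (@ptws_eval_continuous nat int n 0%R [set 0%R] (discrete_set1 _)).
Qed.

End Subgroup.

(** Signs and absolute values on the first [m] coordinates form a finite code, and one
    representative per code suffices. Representatives are picked in [X], since the finite sets must
    lie in the group itself. *)
Lemma finite_restrictions (X : choiceType) (x0 : X) (v : X -> nat -> int)
    (m b : nat) :
  exists2 F : set X, finite_set F &
    forall x, (forall i, i < m -> absz (v x i) <= b) ->
      exists2 a, F a & forall i, i < m -> v a i = v x i.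
Proof.
pose small x := forall i, i < m -> absz (v x i) <= b.
pose code x : {ffun 'I_m -> bool * 'I_b.+1} :=
  [ffun i : 'I_m => ((v x i < 0)%R, inord (absz (v x i)))].
(* [x0] serves codes that no small element has. Smallness is required because [inord] is faithful
   only up to [b]. *)
pose rep c := xget x0 [set x | small x /\ code x = c].
exists (rep @` setT); first by apply: finite_image; exact: finite_finset.
move=> x sx; exists (rep (code x)); first by exists (code x).
have [sr cr] : small (rep (code x)) /\ code (rep (code x)) = code x.
  by apply: (@xgetPex _ x0 [set y | small y /\ code y = code x]); exists x.
move=> i ltim; have /ffunP/(_ (Ordinal ltim)) := cr; rewrite !ffunE /=.
move=> [es /(congr1 val)]; rewrite /= !inordK ?ltnS ?sr ?sx// => ea.
by rewrite [LHS]intEsign [RHS]intEsign es ea.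
Qed.

Section StrictlyIncreasing.
Variable a : nat -> nat.
Hypothesis a_incr : {homo a : m n / m < n}.

Lemma incr_id_le n : n <= a n.
Proof. by elim: n => // n IH; apply: leq_ltn_trans IH (a_incr _). Qed.

Lemma incr_interval n : a 0 <= n -> exists k, a k <= n < a k.+1.
Proof.
move=> a0n; have ub k : a k <= n -> k <= n by apply: leq_trans (incr_id_le k).
have exk : exists k, a k <= n by exists 0.
case: (ex_maxnP exk ub) => k akn kmax; exists k; rewrite akn ltnNge.
by apply/negP => /kmax; rewrite ltnn.
Qed.

End StrictlyIncreasing.

Section Ultrafilter.
Variables (U : set_system nat) (UU : UltraFilter U) (Uoo : \oo `<=` U).

Definition tame (f : nat -> int) :=
  exists K, U [set n | forall i, i <= n -> absz (f i) <= K * n].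

Lemma tame0 : tame (fun=> 0%R).
Proof. by exists 0; apply: filterS filterT. Qed.

Lemma tameB f g : tame f -> tame g -> tame (fun i => f i - g i)%R.
Proof.
move=> [K fK] [L gL]; exists (K + L); apply: filterS2 fK gL => n fn gn i lein.
have := fn i lein; have := gn i lein; rewrite mulnDl; lia.
Qed.

(** Each constant [K] is absorbed as soon as [n >= K], and a filter is closed under finite
    intersections. *)
Lemma finite_tame (X : choiceType) (v : X -> nat -> int) (A : set X) :
    finite_set A -> (forall x, tame (v x)) ->
  U [set n | forall x, A x -> forall i, i <= n -> absz (v x i) <= n * n].
Proof.
move=> /finite_fsetP [D ->] tv.
pose B x := [set n | forall i, i <= n -> absz (v x i) <= n * n].
have : U (\bigcap_(x in [set` D]) B x).
  apply: filter_bigI => x _; have [K vK] := tv x.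
  apply: filterS2 vK (Uoo (nbhs_infty_ge K)) => n vn Kn i lein.
  by apply: leq_trans (vn i lein) _; rewrite leq_mul2r Kn orbT.
by apply: filterS => n Bn x Dx; exact: Bn.
Qed.

Lemma tame_unbounded (h : nat -> nat) :
  exists2 f, tame f & forall N, exists2 n, N <= n & h n < absz (f n).
Proof.
(* Each term exceeds both its predecessor and the value of [h] there. *)
pose a k := iter k (fun x => (x + h x).+1) 0.
have aS k : a k.+1 = (a k + h (a k)).+1 by [].
have a_incr : {homo a : m n / m < n}.
  by apply: homo_ltn => [y x z|i]; [exact: ltn_trans|rewrite aS; lia].
have a_le := leq_mono a_incr; have a_lt := leqW_mono a_le.
have /choice [p pP] n : exists k, a k <= n < a k.+1 by exact: incr_interval.
have p_mono i n : i <= n -> p i <= p n.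
  move=> lein; have /andP[api _] := pP i; have /andP[_ npa] := pP n.
  by rewrite -ltnS -a_lt (leq_ltn_trans api)// (leq_ltn_trans lein).
have pa k : p (a k) = k.
  by apply/eqP; have := pP (a k); rewrite a_le a_lt; lia.
have [b Ub] : exists b, U [set n | odd (p n) = b].
  have [Ho|Ho] := in_ultra_setVsetC [set n | odd (p n) = true] UU.
    by exists true.
  by exists false; apply: filterS Ho => n /negP/negbTE.
pose f n := if odd (p n) == b then a (p n) else a (p n).+1.
exists (fun n => Posz (f n)).
  exists 1; apply: filterS Ub => n /= pnb i lein; rewrite mul1n.
  have /andP[apn _] := pP n; apply: leq_trans apn; rewrite /f.
  case: ifP => [_|pib]; rewrite a_le ?p_mono//.
  (* The interval of [i] has the wrong parity and that of [n] the right one, so [p i < p n] and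
     [a (p i).+1 <= a (p n) <= n]. *)
  rewrite ltn_neqAle p_mono// andbT; apply: contraFneq pib => ->.
  by rewrite pnb.
(* [k] is the first index from [N] on with the wrong parity, so [f (a k) = a k.+1 > h (a k)]. *)
move=> N; pose k := if odd N == b then N.+1 else N.
have okb : (odd k == b) = false.
  by rewrite /k; case: b {Ub f k}; case: ifP => //=; case: (odd N).
have Nk : N <= k by rewrite /k; case: ifP => _ //; exact: leqnSn.
exists (a k); first exact: leq_trans Nk (incr_id_le a_incr k).
by rewrite /f pa okb absz_nat aS; lia.
Qed.

Variable G : zmodClosed {ptws nat -> int}.
Hypothesis G_tame : forall f : {ptws nat -> int}, (f \in G) <-> tame f.

Let coord (g : subgroup_type G) (i : nat) : int := (val g : {ptws nat -> int}) i.

Lemma tame_Scheepers_bounded : Scheepers_bounded (subgroup_type G).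
Proof.
move=> V V0.
have /choice [m mV] n := subgroup_nbhs0 (V0 n).
(* [F k] must be fixed before the good [n] is known. If [M k <= n < M k.+1], then [n] lies beyond
   [m k], and [n * n] is at most [M k.+1 * M k.+1], the bound used for [F k]. *)
pose M k := \sum_(j < k.+1) (m j).+1.
have MS k : M k.+1 = M k + (m k.+1).+1 by rewrite /M big_ord_recr.
have M_incr : {homo M : i j / i < j}.
  by apply: homo_ltn => [y x z|i]; [exact: ltn_trans|rewrite MS; lia].
have mM k : m k < M k by rewrite /M big_ord_recr /=; lia.
have reps k := finite_restrictions (0%R : subgroup_type G) coord (m k)
  (M k.+1 * M k.+1).
pose F k := projT1 (cid2 (reps k)).
exists F => [k|A finA]; first by rewrite /F; case: cid2.
have tG g : tame (coord g) by apply/G_tame; exact: (valP g).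
have [n [An M0n]] := filter_ex
  (filterI (finite_tame finA tG) (Uoo (nbhs_infty_ge (M 0)))).
have [k /andP[Mkn nMk]] := incr_interval M_incr M0n.
exists k => g Ag.
have [a Fa ag] : exists2 a, F k a & forall i, i < m k -> coord a i = coord g i.
  rewrite /F; case: cid2 => /= E _; apply=> i ltim.
  apply: leq_trans (An g Ag i _) _; first by have := mM k; lia.
  by apply: leq_mul; exact: ltnW.
exists a => //; exists (g - a)%R; last by rewrite addrC subrK.
apply: mV => i ltim; apply/eqP; rewrite subr_eq0; apply/eqP.
by rewrite -[LHS]/(coord g i) -ag.
Qed.

(** For the neighborhoods [g n = 0], membership in [F n + U n] forces [g n] to agree with some
    [a n], [a] in [F n]. Hurewicz-boundedness would thus give one [h] eventually dominating all of
    [G]. *)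
Lemma tame_not_Hurewicz_bounded : ~ Hurewicz_bounded (subgroup_type G).
Proof.
move=> /(_ _ (nbhs0_coord_eq0 G)) [F finF HF].
have /choice [h hP] n : exists b, forall a, F n a -> absz (coord a n) <= b.
  have /finite_seqP[s sE] := finF n; exists (\max_(a <- s) absz (coord a n)).
  move=> a; rewrite sE /= => sa; exact: leq_bigmax_seq.
have [f tf fh] := tame_unbounded h.
have fG : (f : {ptws nat -> int}) \in G by apply/G_tame.
have [N _ NF] := HF (Sub (f : {ptws nat -> int}) fG : subgroup_type G).
have [n Nn] := fh N.
have [a Fa [c /= c0 /(congr1 (coord^~ n))]] := NF n Nn.
rewrite {2}/coord SubK => <-; rewrite ltnNge => /negP; apply.
have -> : coord (a + c)%R n = (coord a n + coord c n)%R by [].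
by rewrite [coord c n]c0 addr0 hP.
Qed.

End Ultrafilter.

Theorem theorem7p3 :
  exists G : zmodClosed {ptws nat -> int},
    Scheepers_bounded (subgroup_type G) /\ ~ Hurewicz_bounded (subgroup_type G).
Proof.
have [U [UU Uoo]] := ultraFilterLemma eventually_filter.
have [G GP] := @zmodClosed_of_set {ptws nat -> int} (tame U) (tame0 UU) (@tameB U UU).
exists G; split; first exact: tame_Scheepers_bounded GP.
exact: tame_not_Hurewicz_bounded GP.
Qed.
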